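(* Let $D$ be a nonempty finite set of pixels of the regular orthogonal grid in $\mathbb{R}^2$ (a digital object). Let $p$ be the number of pixels of $D$, $v$ the number of distinct grid points that are a vertex of at least one pixel of $D$, $h$ the number of holes of $D$, $c$ the number of connected components of $D$, $b$ the number of 2-blocks of $D$, and $t$ the number of $0$-tunnels of $D$ (all as defined in the context). Then $$t = v - 2(p + c - h) + b.$$
   Context: Pixels are the closed unit squares of $\mathbb{R}^2$ centered at the points of $\mathbb{Z}^2$; a pixel has four vertices (grid points with half-integer coordinates). Two pixels are $0$-adjacent if they share a vertex and $1$-adjacent if they share an edge. A $k$-path ($k\in\{0,1\}$) is a sequence of pixels in which consecutive pixels are $k$-adjacent; the $k$-components of a set of pixels are its maximal $k$-connected subsets. The connected components of $D$ counted by $c$ are its $0$-components. The holes of $D$ counted by $h$ are the finite $1$-components of the complement $\mathbb{Z}^2\setminus D$ (the set of all pixels not in $D$); the unique infinite $1$-component is not counted. A 2-block of $D$ is a $2\times 2$ square of four pixels all belonging to $D$. A $0$-tunnel of $D$ is a grid point $x$ such that among the four pixels having $x$ as a vertex exactly two belong to $D$ and these two are diagonally opposite (i.e., $0$-adjacent but not $1$-adjacent); $t$ counts such points. *)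

(* Defs.v *)
From mathcomp Require Import all_boot all_order all_algebra finmap.
From mathcomp Require Import boolp classical_sets functions cardinality.

Set Implicit Arguments.
Unset Strict Implicit.
Unset Printing Implicit Defensive.

Local Open Scope classical_set_scope.
Local Open Scope fset_scope.
Local Open Scope ring_scope.

(** A pixel is represented by its center in Z^2, and the grid point
    (a + 1/2, b + 1/2) is represented by the pair (a, b). *)
Definition pixel := (int * int)%type.
Definition grid_point := (int * int)%type.

Definition sw (p : pixel) : grid_point := (p.1 - 1, p.2 - 1).
Definition se (p : pixel) : grid_point := (p.1, p.2 - 1).
Definition nw (p : pixel) : grid_point := (p.1 - 1, p.2).
Definition ne (p : pixel) : grid_point := (p.1, p.2).

Definition vertices (p : pixel) : seq grid_point :=
  [:: sw p; se p; nw p; ne p].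

(** An edge is the pair of its end points, always listed from left to right or
    from bottom to top, so that two pixels have an edge in common exactly when
    the same pair is listed for both. *)
Definition edges (p : pixel) : seq (grid_point * grid_point) :=
  [:: (sw p, se p); (nw p, ne p); (sw p, nw p); (se p, ne p)].

Definition pixel_adj0 : rel pixel := fun p q =>
  (p != q) && has (fun x => x \in vertices q) (vertices p).

Definition pixel_adj1 : rel pixel := fun p q =>
  (p != q) && has (fun e => e \in edges q) (edges p).

(** [adj] is [pixel_adj0] or [pixel_adj1]; the path is [p :: s] and must stay inside [C]. *)
Definition connected_by (adj : rel pixel) (C : set pixel) : Prop :=
  forall p q : pixel, C p -> C q ->
    exists s : seq pixel,
      [/\ path adj p s, last p s = q & forall r, r \in p :: s -> C r].

Definition component (adj : rel pixel) (S C : set pixel) : Prop :=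
  [/\ C !=set0, C `<=` S, connected_by adj C &
      forall C' : set pixel,
        C' `<=` S -> connected_by adj C' -> C `<=` C' -> C' = C]%classic.

Definition components (D : {fset pixel}) : set (set pixel) :=
  [set C | component pixel_adj0 [set` D] C]%classic.

Definition holes (D : {fset pixel}) : set (set pixel) :=
  [set C | component pixel_adj1 (~` [set` D]) C /\ finite_set C]%classic.

Definition object_vertices (D : {fset pixel}) : set grid_point :=
  [set x | exists2 p, p \in D & x \in vertices p]%classic.

Definition square2 (p : pixel) : {fset pixel} :=
  [fset p; (p.1 + 1, p.2); (p.1, p.2 + 1); (p.1 + 1, p.2 + 1)].

Definition blocks (D : {fset pixel}) : set {fset pixel} :=
  [set B | (exists p, B = square2 p) /\ (B `<=` D)%fset]%classic.

Definition tunnels (D : {fset pixel}) : set grid_point :=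
  [set x | exists p q : pixel,
     [/\ [fset r in D | x \in vertices r] = [fset p; q],
         pixel_adj0 p q & ~~ pixel_adj1 p q]]%classic.

(** Number of elements of a finite set; [fset_set] sends infinite sets to
    the empty one, but only finite sets are counted. For the set of holes:
    holes are disjoint, and each contains a pixel 1-adjacent to one of [D]. *)
Definition set_card (T : choiceType) (A : set T) : nat := #|` fset_set A |.

(* Main.v *)
(** The edges and grid points of [D] form a finite plane graph with incidence
    matrix [A]. The left kernel of [A] consists of the functions on grid points
    that are constant on the components of [D], so it has dimension [c]. The
    right kernel consists of the cycles; since the plane has no homology in
    degrees 1 and 2, every cycle is the boundary of exactly one finitely
    supported function on pixels, and the boundary lives on the edges of [D] iff
    the function is constant on each 1-component of the complement (hence zero
    on the infinite one). So the right kernel has dimension [p + h], and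
    comparing ranks gives Euler's formula [v + p + h = e + c]. Summing over
    grid points an identity on the four surrounding pixels gives
    [2 e + b = v + 4 p + t]; eliminate [e]. *)
Require Import Defs.
From mathcomp Require Import all_boot all_order all_algebra finmap.
From mathcomp Require Import boolp classical_sets functions cardinality.
From mathcomp Require Import ring zify.

Set Implicit Arguments.
Unset Strict Implicit.
Unset Printing Implicit Defensive.

Import Order.TTheory GRing.Theory Num.Theory.
Local Open Scope fset_scope.
Local Open Scope ring_scope.

(** * Exactness and ranks *)

(** Exactness of [0 -> F^K -> F^V -> F^E] at [F^K] and [F^V]. *)
Lemma rank_exact (F : fieldType) (TK TV TE : eqType)
    (K : seq TK) (V : seq TV) (E : seq TE)
    (chi : TK -> TV -> F) (d : TV -> TE -> F) :
  uniq K -> uniq V ->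
  (forall w : TK -> F,
     {in V, forall x, \sum_(k <- K) w k * chi k x = 0} -> {in K, w =1 fun=> 0}) ->
  {in K & E, forall k e, \sum_(x <- V) chi k x * d x e = 0} ->
  (forall u : TV -> F, {in E, forall e, \sum_(x <- V) u x * d x e = 0} ->
     exists w : TK -> F, {in V, forall x, u x = \sum_(k <- K) w k * chi k x}) ->
  (size K + \rank (\matrix_(i < size V, j < size E)
     d (tnth (in_tuple V) i) (tnth (in_tuple E) j)) = size V)%N.
Proof.
move=> uK uV chi_inj chi_ker ker_chi; set A := (X in \rank X).
(* [fn] extends a row vector to a function on the whole type; the value 0 off [s] is a dummy, as all
   sums and conclusions stay inside [s]. *)
pose fn (T : eqType) (s : seq T) (r : 'rV[F]_(size s)) (x : T) :=
  if insub (index x s) is Some i then r 0 i else 0.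
have fnE (T : eqType) (s : seq T) (r : 'rV[F]_(size s)) i :
    uniq s -> fn _ _ r (tnth (in_tuple s) i) = r 0 i.
  move=> us; rewrite /fn (tnth_nth (tnth (in_tuple s) i)) /= index_uniq //.
  by rewrite valK.
(* The rows of [C] turn out to be a basis of the left kernel of [A], so that this kernel has
   dimension [size K]. *)
pose C := \matrix_(k < size K, i < size V)
  chi (tnth (in_tuple K) k) (tnth (in_tuple V) i).
have memt (T : eqType) (s : seq T) i : tnth (in_tuple s) i \in s by exact: mem_tnth.
have freeC : row_free C.
  rewrite -kermx_eq0; apply/rowV0P => r /sub_kermxP rC0.
  have /chi_inj w0 : {in V, forall x, \sum_(k <- K) fn _ _ r k * chi k x = 0}.
    move=> x /(tnthP (in_tuple V))[i ->]; rewrite big_tnth.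
    have /matrixP/(_ 0 i) := rC0; rewrite !mxE; apply: etrans.
    by apply: eq_bigr => k _; rewrite mxE fnE.
  by apply/rowP => k; rewrite -fnE // w0 // mxE.
have CA0 : C *m A = 0.
  apply/matrixP => k e; have := chi_ker _ _ (memt _ _ k) (memt _ _ e).
  rewrite !mxE big_tnth; apply: etrans.
  by apply: eq_bigr => i _; rewrite !mxE.
have kerC : (kermx A <= C)%MS.
  apply/rV_subP => r /sub_kermxP rA0.
  have /ker_chi[w wE] : {in E, forall e, \sum_(x <- V) fn _ _ r x * d x e = 0}.
    move=> x /(tnthP (in_tuple E))[e ->]; rewrite big_tnth.
    have /matrixP/(_ 0 e) := rA0; rewrite !mxE; apply: etrans.
    by apply: eq_bigr => k _; rewrite mxE fnE.
  apply/submxP; exists (\row_k w (tnth (in_tuple K) k)).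
  apply/rowP => i; rewrite !mxE -fnE // wE // big_tnth.
  by apply: eq_bigr => k _; rewrite !mxE.
have eqC : \rank C = \rank (kermx A).
  by apply/eqP; rewrite eqn_leq mxrankS ?mxrankS // sub_kermx CA0.
move/eqP: freeC; rewrite eqC mxrank_ker => <-.
by rewrite subnK // rank_leq_row.
Qed.

(** The rank of the matrix of [d] is [size V - size K] by its left kernel and, passing to the
    transpose, [size E - size Q] by its right kernel. *)
Lemma euler_exact (F : fieldType) (TK TV TE TQ : eqType)
    (K : seq TK) (V : seq TV) (E : seq TE) (Q : seq TQ)
    (chi : TK -> TV -> F) (d : TV -> TE -> F) (beta : TQ -> TE -> F) :
  uniq K -> uniq V -> uniq E -> uniq Q ->
  (forall w : TK -> F,
     {in V, forall x, \sum_(k <- K) w k * chi k x = 0} -> {in K, w =1 fun=> 0}) ->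
  {in K & E, forall k e, \sum_(x <- V) chi k x * d x e = 0} ->
  (forall u : TV -> F, {in E, forall e, \sum_(x <- V) u x * d x e = 0} ->
     exists w : TK -> F, {in V, forall x, u x = \sum_(k <- K) w k * chi k x}) ->
  (forall w : TQ -> F,
     {in E, forall e, \sum_(q <- Q) w q * beta q e = 0} -> {in Q, w =1 fun=> 0}) ->
  {in Q & V, forall q x, \sum_(e <- E) beta q e * d x e = 0} ->
  (forall g : TE -> F, {in V, forall x, \sum_(e <- E) g e * d x e = 0} ->
     exists w : TQ -> F, {in E, forall e, g e = \sum_(q <- Q) w q * beta q e}) ->
  (size V + size Q = size E + size K)%N.
Proof.
move=> uK uV uE uQ chi_inj chi_ker ker_chi beta_inj beta_ker ker_beta.
have := rank_exact uK uV chi_inj chi_ker ker_chi.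
have := rank_exact (d := fun e x => d x e) uQ uE beta_inj beta_ker ker_beta.
rewrite -mxrank_tr; set M := (\rank _); set M' := (\rank _).
have -> : M = M' by congr (\rank _); apply/matrixP => i j; rewrite !mxE.
lia.
Qed.

(** * Components as linkage classes *)

Section Components.
Variables (adj : rel pixel) (S : set pixel).
Hypothesis adjC : symmetric adj.

(** The relation inside [connected_by], but with paths confined to the ambient [S]; its classes are
    the components. *)
Definition linked (p q : pixel) : Prop :=
  exists s, [/\ path adj p s, last p s = q & forall r, r \in p :: s -> S r].

Lemma linked_refl p : S p -> linked p p.
Proof. by move=> Sp; exists [::]; split=> // r; rewrite inE => /eqP->. Qed.

Lemma linked_sym p q : linked p q -> linked q p.
Proof.
case=> s [ps <- sS]; exists (rev (belast p s)); split.
- by rewrite rev_path (eq_path (e' := adj)).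
- by case: s {ps sS} => //= r s; rewrite rev_cons last_rcons.
- move=> r rs; apply: sS; rewrite lastI mem_rcons.
  by move: rs; rewrite !inE mem_rev.
Qed.

Lemma linked_trans q p r : linked p q -> linked q r -> linked p r.
Proof.
case=> s [ps <- sS] [s' [ps' <- sS']]; exists (s ++ s'); split.
- by rewrite cat_path ps.
- by rewrite last_cat.
- move=> x; rewrite -cat_cons mem_cat => /orP[/sS//|xs'].
  by apply: sS'; rewrite inE xs' orbT.
Qed.

Lemma linked_adj p q : S p -> S q -> adj p q -> linked p q.
Proof.
move=> Sp Sq pq; exists [:: q]; split=> /=; first by rewrite pq.
  by [].
by move=> r; rewrite !inE => /orP[] /eqP->.
Qed.

Lemma linked_mem p q : linked p q -> S q.
Proof. by case=> s [_ <- sS]; apply/sS/mem_last. Qed.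

Lemma linked_ind (T : Type) (f : pixel -> T) :
  (forall p q, S p -> S q -> adj p q -> f p = f q) ->
  forall p q, linked p q -> f p = f q.
Proof.
move=> fE p q [s [ps <- sS]]; elim: s p ps sS => //= r s IHs p /andP[pr rs] sS.
rewrite (fE p r) //; first 1 last.
- by apply: sS; rewrite inE eqxx.
- by apply: sS; rewrite !inE eqxx orbT.
- by apply: IHs => // x xs; apply: sS; rewrite inE xs orbT.
Qed.

(** A path in [S] never leaves the class of its start, because each of its prefixes is a linking
    path. *)
Lemma linked_connected p : connected_by adj (linked p).
Proof.
move=> q r pq pr.
have [s [qs sr sS]] := linked_trans (linked_sym pq) pr.
exists s; split=> // x xs; apply: linked_trans pq _.
case/splitPl: xs qs sr sS => s1 s2 <-; rewrite cat_path => /andP[qs1 _] _ sS.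
exists s1; split=> // y ys; apply: sS.
by rewrite -cat_cons mem_cat ys.
Qed.

(** The class of [p] is connected and contains [C], so maximality forces equality; a component is
    thus determined by any of its pixels. *)
Lemma component_linked C p : component adj S C -> C p -> C = linked p.
Proof.
case=> _ CS Cc Cmax Cp.
symmetry; apply: Cmax; first by move=> q /linked_mem.
  exact: linked_connected.
move=> q /(Cc _ _ Cp)[s [ps sq sC]]; exists s; split=> // r /sC; exact: CS.
Qed.

Lemma linked_component p : S p -> component adj S (linked p).
Proof.
move=> Sp; split.
- by exists p; exact: linked_refl.
- by move=> q /linked_mem.
- exact: linked_connected.
move=> C CS Cc pC; apply/seteqP; split=> // q Cq.
have Cp : C p by apply/pC/linked_refl.
have [s [ps sq sC]] := Cc _ _ Cp Cq; exists s; split=> // r /sC; exact: CS.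
Qed.

End Components.

(** * The grid graph *)

(** [(true, x)] is the horizontal edge from [x] to the right, [(false, x)] the
    vertical edge from [x] upwards; [lside] and [rside] are the pixels to the
    left and to the right when the edge is travelled from [src] to [tgt]. *)
Definition grid_edge := (bool * grid_point)%type.

Definition src (e : grid_edge) : grid_point := e.2.
Definition tgt (e : grid_edge) : grid_point :=
  if e.1 then (e.2.1 + 1, e.2.2) else (e.2.1, e.2.2 + 1).

Definition lside (e : grid_edge) : pixel :=
  if e.1 then (e.2.1 + 1, e.2.2 + 1) else (e.2.1, e.2.2 + 1).
Definition rside (e : grid_edge) : pixel :=
  if e.1 then (e.2.1 + 1, e.2.2) else (e.2.1 + 1, e.2.2 + 1).

Lemma adj0_sym : symmetric pixel_adj0.
Proof.
move=> p q; rewrite /pixel_adj0 eq_sym; congr (_ && _).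
by apply/hasP/hasP => -[x xp xq]; exists x.
Qed.

Lemma vertex_adj0 (x : grid_point) (p q : pixel) :
  p != q -> x \in vertices p -> x \in vertices q -> pixel_adj0 p q.
Proof. by move=> pq xp xq; rewrite /pixel_adj0 pq; apply/hasP; exists x. Qed.

Lemma adj0_vertex (p q : pixel) :
  pixel_adj0 p q -> exists2 x, x \in vertices p & x \in vertices q.
Proof. by case/andP=> _ /hasP. Qed.

Lemma adj1_sym : symmetric pixel_adj1.
Proof.
move=> p q; rewrite /pixel_adj1 eq_sym; congr (_ && _).
by apply/hasP/hasP => -[x xp xq]; exists x.
Qed.

Lemma mem_vertices (x : grid_point) (p : pixel) :
  x \in vertices p =
  ((x.1 == p.1) || (x.1 + 1 == p.1)) && ((x.2 == p.2) || (x.2 + 1 == p.2)).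
Proof.
case: x p => [x y] [a b].
have B1 (u v : int) : (u == v - 1) = (u + 1 == v) by lia.
rewrite !inE /sw /se /nw /ne !xpair_eqE /= !B1.
by do 4 case: (_ == _).
Qed.

(** Sharing an edge becomes distance 1 in the l1 norm, a form that [lia] can decide. *)
Lemma adj1E (p q : pixel) :
  pixel_adj1 p q = (`|p.1 - q.1| + `|p.2 - q.2| == 1).
Proof.
case: p q => [a b] [c d].
rewrite /pixel_adj1 /= !inE /sw /se /nw /ne !xpair_eqE /=.
have BB (u v : int) : (u - 1 == v - 1) = (u == v) by lia.
have BR (u v : int) : (u == v - 1) = (v == u + 1) by lia.
have BL (u v : int) : (u - 1 == v) = (u == v + 1) by lia.
rewrite !BB !BR !BL {BB BR BL}.
have nS (u : int) : (u == u + 1) = false by lia.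
have [->|ac] := eqVneq a c; have [->|bd] := eqVneq b d;
  rewrite ?eqxx ?nS /= ?andbF ?andbT ?orbF /=; lia.
Qed.

Lemma adj1_sides (e : grid_edge) : pixel_adj1 (lside e) (rside e).
Proof. case: e => [[] [a b]]; rewrite adj1E /lside /rside /=; lia. Qed.

Lemma adj1_edge (p q : pixel) : pixel_adj1 p q ->
  exists e, (p = lside e /\ q = rside e) \/ (p = rside e /\ q = lside e).
Proof.
case: p q => [a b] [c d]; rewrite adj1E /= => pq.
have [ac|ac|ac] := ltgtP a c.
- exists (false, (a, b - 1)); left; rewrite /lside /rside /=.
  by split; congr pair; lia.
- exists (false, (c, b - 1)); right; rewrite /lside /rside /=.
  by split; congr pair; lia.
have [bd|bd|bd] := ltgtP b d.
- exists (true, (a - 1, b)); right; rewrite /lside /rside /=.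
  by split; congr pair; lia.
- exists (true, (a - 1, d)); left; rewrite /lside /rside /=.
  by split; congr pair; lia.
- lia.
Qed.

Lemma mem_vertices_side (e : grid_edge) :
  [/\ src e \in vertices (lside e), tgt e \in vertices (lside e),
      src e \in vertices (rside e) & tgt e \in vertices (rside e)].
Proof.
by case: e => [[] [a b]]; rewrite !mem_vertices /src /tgt /lside /rside /=;
  split; lia.
Qed.

(** * Vertices and edges of the object *)

Section Object.
Variable D : {fset pixel}.

Definition vertex_set : {fset grid_point} :=
  [fset x | x in flatten [seq vertices p | p <- D]].

Definition edge_set : {fset grid_edge} :=
  [fset e | e in flatten [seq [:: (true, sw p); (true, nw p);
                                  (false, sw p); (false, se p)] | p <- D]].

Lemma mem_vertex_setP x :
  reflect (exists2 p, p \in D & x \in vertices p) (x \in vertex_set).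
Proof. by rewrite in_fset; apply: flatten_mapP. Qed.

Lemma mem_vertex_set (x : grid_point) : x \in vertex_set =
  [|| x \in D, (x.1 + 1, x.2) \in D, (x.1, x.2 + 1) \in D |
      (x.1 + 1, x.2 + 1) \in D].
Proof.
case: x => x y; apply/mem_vertex_setP/idP => [[[a b] pD]|].
  rewrite mem_vertices /= => /andP[/orP[]/eqP-> /orP[]/eqP->];
  by rewrite pD ?orbT.
by case/or4P => pD; eexists; try exact: pD; rewrite mem_vertices /=; lia.
Qed.

Lemma mem_edge_set e : e \in edge_set = (lside e \in D) || (rside e \in D).
Proof.
rewrite in_fset; apply/flatten_mapP/orP.
  case=> -[a b] pD; rewrite !inE /sw /nw /se => /or4P[] /eqP->;
    rewrite /lside /rside /= ?subrK; tauto.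
case: e => [[] [x y]] [] pD; eexists; try exact: pD;
  by rewrite /lside /rside /sw /nw /se /= !inE !xpair_eqE /=; lia.
Qed.

Lemma mem_src e : e \in edge_set -> src e \in vertex_set.
Proof.
have [? ? ? ?] := mem_vertices_side e.
rewrite mem_edge_set => /orP[] eD; apply/mem_vertex_setP.
  by exists (lside e).
by exists (rside e).
Qed.

Lemma mem_tgt e : e \in edge_set -> tgt e \in vertex_set.
Proof.
have [? ? ? ?] := mem_vertices_side e.
rewrite mem_edge_set => /orP[] eD; apply/mem_vertex_setP.
  by exists (lside e).
by exists (rside e).
Qed.

End Object.

(** * Counting around grid points *)

(** Counts are turned into sums of indicators over one index set, so that they can be compared term
    by term. *)
Lemma card_image_sum (T T' : choiceType) (X : {fset T}) (P : pred T)
    (psi : T -> T') (A : {fset T'}) :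
  injective psi ->
  (forall x, x \in X -> P x -> psi x \in A) ->
  (forall y, y \in A -> exists x, [/\ x \in X, P x & y = psi x]) ->
  #|` A| = (\sum_(x <- X) P x)%N.
Proof.
move=> psi_inj XA AX.
have -> : A = [fset psi x | x in [seq x <- X | P x]].
  apply/fsetP => y; apply/idP/imfsetP => [/AX[x [xX Px ->]]|[x /=]].
    by exists x; rewrite //= mem_filter Px.
  by rewrite mem_filter => /andP[Px xX ->]; exact: XA.
rewrite card_imfset //= undup_id ?filter_uniq ?fset_uniq //.
by rewrite size_filter -sumn_count sumnE big_map.
Qed.

Lemma set_card_image_sum (T T' : choiceType) (X : {fset T}) (P : pred T)
    (psi : T -> T') (A : set T') :
  injective psi ->
  (forall x, x \in X -> P x -> A (psi x)) ->
  (forall y, A y -> exists x, [/\ x \in X, P x & y = psi x]) ->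
  set_card A = (\sum_(x <- X) P x)%N.
Proof.
move=> psi_inj XA AX.
have finA : finite_set A.
  apply: (@sub_finite_set _ _ (psi @` [set` X])).
    by move=> y /AX[x [xX _ ->]]; exists x.
  exact: finite_image.
apply: (card_image_sum psi_inj) => [x xX Px|y].
  by rewrite in_fset_set // inE; exact: XA.
by rewrite in_fset_set // inE => /AX.
Qed.

(** Edges are split by direction and each is charged to one grid point: the identity as [f] charges
    the source, a shift back by one charges the target. *)
Lemma card_edges_sum (E : {fset grid_edge}) (X : {fset grid_point})
    (f f' : bool -> grid_point -> grid_point) :
  (forall b, cancel (f b) (f' b)) -> (forall b, cancel (f' b) (f b)) ->
  (forall b x, (b, f b x) \in E -> x \in X) ->
  #|` E| = (\sum_(x <- X) ((true, f true x) \in E)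
            + \sum_(x <- X) ((false, f false x) \in E))%N.
Proof.
move=> fK f'K EX.
have cardE b : #|` [fset e in E | e.1 == b]| = (\sum_(x <- X) ((b, f b x) \in E))%N.
  apply: (card_image_sum (psi := fun x => (b, f b x) : grid_edge)).
  - by move=> x y [] /(can_inj (fK b)).
  - by move=> x _ xE; rewrite !inE xE eqxx.
  - move=> [b' x]; rewrite !inE /= => /andP[xE /eqP bb']; rewrite {}bb' in xE *.
    by exists (f' b x); split; rewrite ?f'K //; apply: (EX b); rewrite f'K.
have EU : E = [fset e in E | e.1 == true] `|` [fset e in E | e.1 == false].
  by apply/fsetP => e; rewrite !inE; case: e.1; rewrite ?andbT ?andbF ?orbF.
have EI : [fset e in E | e.1 == true] `&` [fset e in E | e.1 == false] = fset0.
  by apply/fsetP => e; rewrite !inE; case: e.1; rewrite ?andbF.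
by rewrite {1}EU cardfsU EI cardfs0 subn0 !cardE.
Qed.

Section LocalCount.
Variable D : {fset pixel}.
Let V := vertex_set D.
(* The four pixels around the grid point [x]: upper/lower, left/right. *)
Let ul (x : grid_point) := (x.1, x.2 + 1) \in D.
Let ur (x : grid_point) := (x.1 + 1, x.2 + 1) \in D.
Let ll (x : grid_point) := x \in D.
Let lr (x : grid_point) := (x.1 + 1, x.2) \in D.

Lemma object_verticesE : object_vertices D = [set` V]%classic.
Proof. by apply/seteqP; split=> x /mem_vertex_setP. Qed.

Lemma card_object_vertices : set_card (object_vertices D) = #|` V|.
Proof. by rewrite object_verticesE /set_card set_fsetK. Qed.

Lemma card_vertices : #|` V| = (\sum_(x <- V) [|| ll x, lr x, ul x | ur x])%N.
Proof.
apply: (card_image_sum (psi := id)) => // x xV; exists x; split=> //.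
by rewrite -mem_vertex_set.
Qed.

(** Each pixel is charged to its north-east vertex here and to its other three vertices in the next
    lemmas, which yields the term [4 p]. *)
Lemma card_pixels_ll : #|` D| = (\sum_(x <- V) ll x)%N.
Proof.
apply: (card_image_sum (psi := id)) => // x xD; exists x; split=> //.
by rewrite mem_vertex_set xD.
Qed.

Lemma card_pixels_lr : #|` D| = (\sum_(x <- V) lr x)%N.
Proof.
apply: (card_image_sum (psi := fun x : grid_point => (x.1 + 1, x.2) : pixel)) => //.
  by move=> [a b] [c d] [] /addIr-> ->.
move=> [a b] xD; exists (a - 1, b).
by rewrite mem_vertex_set /lr /= subrK xD ?orbT.
Qed.

Lemma card_pixels_ul : #|` D| = (\sum_(x <- V) ul x)%N.
Proof.
apply: (card_image_sum (psi := fun x : grid_point => (x.1, x.2 + 1) : pixel)) => //.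
  by move=> [a b] [c d] [] -> /addIr->.
move=> [a b] xD; exists (a, b - 1).
by rewrite mem_vertex_set /ul /= subrK xD ?orbT.
Qed.

Lemma card_pixels_ur : #|` D| = (\sum_(x <- V) ur x)%N.
Proof.
apply: (card_image_sum (psi := fun x : grid_point => (x.1 + 1, x.2 + 1) : pixel)) => //.
  by move=> [a b] [c d] [] /addIr-> /addIr->.
move=> [a b] xD; exists (a - 1, b - 1).
by rewrite mem_vertex_set /ur /= !subrK xD ?orbT.
Qed.

Lemma card_edges_src :
  #|` edge_set D| = (\sum_(x <- V) (ur x || lr x) + \sum_(x <- V) (ul x || ur x))%N.
Proof.
rewrite (@card_edges_sum _ V (fun=> id) (fun=> id)) //; last first.
  by move=> b x /mem_src.
by congr addn; apply: eq_bigr => x _; rewrite mem_edge_set.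
Qed.

Lemma card_edges_tgt :
  #|` edge_set D| = (\sum_(x <- V) (ul x || ll x) + \sum_(x <- V) (ll x || lr x))%N.
Proof.
rewrite (@card_edges_sum _ V
  (fun b x => if b then (x.1 - 1, x.2) else (x.1, x.2 - 1))
  (fun b x => if b then (x.1 + 1, x.2) else (x.1, x.2 + 1))).
- by congr addn; apply: eq_bigr => -[a b] _; rewrite mem_edge_set /lside /rside /= subrK.
- by move=> [] [a b]; rewrite /= subrK.
- by move=> [] [a b]; rewrite /= addrK.
- by move=> [] [a b] /mem_tgt; rewrite /tgt /= subrK.
Qed.

Lemma mem_square2 (p q : pixel) : q \in square2 p =
  ((q.1 == p.1) || (q.1 == p.1 + 1)) && ((q.2 == p.2) || (q.2 == p.2 + 1)).
Proof.
case: p q => [a b] [c d]; rewrite !inE !xpair_eqE /=.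
by do 4 case: (_ == _).
Qed.

Lemma square2_inj : injective square2.
Proof.
move=> [a b] [c d] pq.
have : (a, b) \in square2 (c, d) by rewrite -pq mem_square2 !eqxx.
have : (c, d) \in square2 (a, b) by rewrite pq mem_square2 !eqxx.
by rewrite !mem_square2 /= => h1 h2; congr pair; lia.
Qed.

Lemma card_blocks :
  set_card (blocks D) = (\sum_(x <- V) [&& ll x, lr x, ul x & ur x])%N.
Proof.
apply: (set_card_image_sum (psi := square2)); first exact: square2_inj.
  move=> x _ /and4P[h1 h2 h3 h4]; split; first by exists x.
  by apply/fsubsetP => q; rewrite !inE -!orbA => /or4P[] /eqP->.
move=> _ [[x ->] /fsubsetP xD]; exists x.
have [h1 h2 h3 h4] : [/\ ll x, lr x, ul x & ur x].
  by split; apply: xD; rewrite mem_square2 /= ?eqxx ?orbT.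
by rewrite h1 h2 h3 h4 mem_vertex_set; split=> //; apply/orP; left.
Qed.

Lemma card_tunnels : set_card (tunnels D) =
  (\sum_(x <- V) ([&& ll x, ur x, ~~ lr x & ~~ ul x] ||
                  [&& lr x, ul x, ~~ ll x & ~~ ur x]))%N.
Proof.
have memD x r : (r \in [fset r in D | x \in vertices r]) = (r \in D) && (x \in vertices r).
  by rewrite !inE.
apply: (set_card_image_sum (psi := id)) => //.
  move=> [x y] _ /orP[] /and4P[]; rewrite /ll /ul /lr /ur /= => h1 h2 h3 h4.
    exists (x, y), (x + 1, y + 1); split; last 1 first.
    - by rewrite adj1E /=; lia.
    - apply/fsetP => -[a b]; rewrite memD mem_vertices /= in_fset2 !xpair_eqE.
      apply/idP/idP => [/andP[abD]|/orP[] /andP[/eqP-> /eqP->]];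
        rewrite ?h1 ?h2 ?eqxx ?orbT //.
      case/andP => /orP[] /eqP xa /orP[] /eqP yb; move: abD; rewrite -xa -yb.
      + by rewrite !eqxx.
      + by rewrite (negPf h4).
      + by rewrite (negPf h3).
      + by rewrite !eqxx orbT.
    - apply: (@vertex_adj0 (x, y)); first by rewrite xpair_eqE; lia.
        by rewrite mem_vertices /= !eqxx.
      by rewrite mem_vertices /= !eqxx !orbT.
  exists (x + 1, y), (x, y + 1); split; last 1 first.
  - by rewrite adj1E /=; lia.
  - apply/fsetP => -[a b]; rewrite memD mem_vertices /= in_fset2 !xpair_eqE.
    apply/idP/idP => [/andP[abD]|/orP[] /andP[/eqP-> /eqP->]];
      rewrite ?h1 ?h2 ?eqxx ?orbT //.
    case/andP => /orP[] /eqP xa /orP[] /eqP yb; move: abD; rewrite -xa -yb.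
    + by rewrite (negPf h3).
    + by rewrite !eqxx orbT.
    + by rewrite !eqxx.
    + by rewrite (negPf h4).
  - apply: (@vertex_adj0 (x, y)); first by rewrite xpair_eqE; lia.
      by rewrite mem_vertices /= !eqxx !orbT.
    by rewrite mem_vertices /= !eqxx !orbT.
move=> [x y] [[p1 p2] [[q1 q2] [Dpq p0q np1q]]].
have memDx r : (r \in D) && ((x, y) \in vertices r) = (r == (p1, p2)) || (r == (q1, q2)).
  by rewrite -memD Dpq in_fset2.
have /andP[pD xp] : ((p1, p2) \in D) && ((x, y) \in vertices (p1, p2)).
  by rewrite memDx eqxx.
have /andP[qD xq] : ((q1, q2) \in D) && ((x, y) \in vertices (q1, q2)).
  by rewrite memDx eqxx orbT.
have pq : (p1, p2) != (q1, q2) by case/andP: p0q.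
exists (x, y); split=> //.
  by apply/mem_vertex_setP; exists (p1, p2).
have := memDx (x, y); have := memDx (x + 1, y).
have := memDx (x, y + 1); have := memDx (x + 1, y + 1).
move: np1q pq xp xq; rewrite !mem_vertices adj1E !xpair_eqE /ll /lr /ul /ur /=.
have nS (u : int) : ((u == u + 1) = false) * ((u + 1 == u) = false) by split; lia.
(* There are sixteen positions of the two pixels around the grid point: coinciding or edge-sharing
   ones contradict [pq] or [np1q], the four opposite ones give the two diagonal patterns. *)
move=> np1q pq /andP[/orP[]/eqP xp1 /orP[]/eqP xp2] /andP[/orP[]/eqP xq1 /orP[]/eqP xq2];
  rewrite -{}xp1 -{}xp2 -{}xq1 -{}xq2 ?eqxx ?nS /= in np1q pq *;
  by rewrite ?orbT ?andbT => -> -> -> -> //; lia.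
Qed.

(** With each edge counted at both ends, the identity is local. Around an occupied grid point, [k]
    pixels touch [k + 1] edges, except that a diagonal pair touches 4 and a full block only 4. *)
Lemma edges_count :
  (2 * #|` edge_set D| + set_card (blocks D) =
   #|` V| + 4 * #|` D| + set_card (tunnels D))%N.
Proof.
have -> : (2 * #|` edge_set D| = #|` edge_set D| + #|` edge_set D|)%N by lia.
have -> : (4 * #|` D| = #|` D| + #|` D| + #|` D| + #|` D|)%N by lia.
rewrite {1}card_edges_src card_edges_tgt card_blocks card_tunnels card_vertices.
rewrite {1}card_pixels_ll {1}card_pixels_lr {1}card_pixels_ul card_pixels_ur.
rewrite -!big_split /=; apply: eq_bigr => x _.
by case: (ll x); case: (lr x); case: (ul x); case: (ur x).
Qed.

End LocalCount.

(** * Finiteness *)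

Lemma sum_pick (F : pzRingType) (T : eqType) (s : seq T) (w ind : T -> F) (q : T) :
  uniq s -> q \in s -> ind q = 1 -> (forall r, r \in s -> r != q -> ind r = 0) ->
  \sum_(r <- s) w r * ind r = w q.
Proof.
move=> us qs indq indr; rewrite (bigD1_seq q) //= indq mulr1 big_seq_cond big1 ?addr0 //.
by move=> r /andP[rs rq]; rewrite indr ?mulr0.
Qed.

Lemma pixel_bound (D : {fset pixel}) : exists N : int,
  forall p : pixel, p \in D -> (`|p.1| <= N) && (`|p.2| <= N).
Proof.
pose N : nat := (\sum_(p <- D) (`|p.1| + `|p.2|))%N.
exists N => p pD.
have : (`|p.1| + `|p.2| <= N)%N by rewrite /N (big_fsetD1 p) //= leq_addr.
lia.
Qed.

Section Holes.
Variables (D : {fset pixel}) (N : int).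
Hypothesis DN : forall p : pixel, p \in D -> (`|p.1| <= N) && (`|p.2| <= N).

Let bg : set pixel := (~` [set` D])%classic.
Let bg_class := linked pixel_adj1 bg.

Lemma outside_infinite (p : pixel) :
  (N < `|p.1|) || (N < `|p.2|) -> ~ finite_set (bg_class p).
Proof.
move=> pN.
(* [u] is the unit step pointing away from the box along a coordinate that already exceeds [N]. *)
have [u [u1 u2]] : exists u : pixel, `|u.1| + `|u.2| = 1 /\
    forall n : nat, (N < `|p.1 + u.1 * n%:Z|) || (N < `|p.2 + u.2 * n%:Z|).
  case/orP: pN => pN.
    have [p0|p0] := lerP 0 p.1.
      by exists (1, 0); split=> // n; rewrite /= ?mul1r ?mulN1r ?mul0r; lia.
    by exists (-1, 0); split=> // n; rewrite /= ?mul1r ?mulN1r ?mul0r; lia.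
  have [p0|p0] := lerP 0 p.2.
    by exists (0, 1); split=> // n; rewrite /= ?mul1r ?mulN1r ?mul0r; lia.
  by exists (0, -1); split=> // n; rewrite /= ?mul1r ?mulN1r ?mul0r; lia.
(* Moving away from the box, the ray from [p] stays in the complement. *)
pose ray (n : nat) : pixel := (p.1 + u.1 * n%:Z, p.2 + u.2 * n%:Z).
have rayS n : bg (ray n).
  by move=> /DN /andP[]; have := u2 n; rewrite /ray /=; lia.
have ray_linked n : bg_class p (ray n).
  elim: n => [|n IHn].
    have -> : ray 0%N = p by rewrite /ray !mulr0 !addr0; case: (p).
    by apply: linked_refl; have := rayS 0%N; rewrite /ray !mulr0 !addr0; case: (p).
  apply: linked_trans IHn _; apply: linked_adj => //.
  by rewrite adj1E /ray /= -[n.+1]addn1 PoszD !mulrDr; apply/eqP; rewrite -[RHS]u1; lia.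
move=> fin; apply: infinite_nat.
have -> : [set: nat]%classic = (ray @^-1` bg_class p)%classic.
  by apply/seteqP; split=> // n _; exact: ray_linked.
apply: finite_preimage fin => m n _ _ [].
move=> /addrI e1 /addrI e2.
have [v1|v1] := eqVneq u.1 0; last by move/(mulfI v1): e1 => -[].
have [v2|v2] := eqVneq u.2 0; last by move/(mulfI v2): e2 => -[].
by move: u1; rewrite v1 v2.
Qed.

Lemma box_finite : finite_set [set p : pixel | (`|p.1| <= N) && (`|p.2| <= N)]%classic.
Proof.
have fin1 : finite_set [set a : int | `|a| <= N]%classic.
  apply: (@sub_finite_set _ _
    ((fun n : nat => n%:Z) @` `I_(`|N|%N).+1 `|` (fun n : nat => - n%:Z) @` `I_(`|N|%N).+1)%classic).
    by move=> a /= aN; have [a0|a0] := lerP 0 a; [left|right];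
      exists `|a|%N => /=; lia.
  by rewrite finite_setU; split; apply: finite_image.
apply: sub_finite_set (finite_setX fin1 fin1).
by move=> [a b] /= /andP[].
Qed.

Lemma hole_bounded C p : holes D C -> C p -> (`|p.1| <= N) && (`|p.2| <= N).
Proof.
move=> [Ccomp Cfin] Cp; apply/negPn/negP => pN.
apply: (@outside_infinite p); first by move: pN; lia.
by rewrite /bg_class -(component_linked adj1_sym Ccomp Cp).
Qed.

(** Each hole is the class of a pixel in the box. Finiteness is what makes [set_card] a genuine
    count here. *)
Lemma holes_finite : finite_set (holes D).
Proof.
apply: sub_finite_set (finite_image bg_class box_finite).
move=> C Chole; have [Ccomp _] := Chole; have [[p Cp] _ _ _] := Ccomp.
by exists p; [exact: hole_bounded Cp|rewrite [RHS](component_linked adj1_sym Ccomp Cp)].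
Qed.

Lemma components_finite : finite_set (components D).
Proof.
have finD : finite_set [set` D]%classic by exact: finite_fset.
apply: sub_finite_set (finite_image (linked pixel_adj0 [set` D]%classic) finD).
move=> C Ccomp; have [[p Cp] CD _ _] := Ccomp.
by exists p; [exact: CD|rewrite (component_linked adj0_sym Ccomp Cp)].
Qed.

End Holes.

(** * The chain complex of the object *)

Section Exactness.
Variable D : {fset pixel}.
Let V := vertex_set D.
Let E := edge_set D.
Let K : {fset (set pixel)} := fset_set (components D).
Let H : {fset (set pixel)} := fset_set (holes D).
Let bg : set pixel := (~` [set` D])%classic.

(** The coefficient of [x] in the boundary of the oriented edge [e]; summed over vertices against a
    function it gives the coboundary. *)
Definition incidence (x : grid_point) (e : grid_edge) : rat :=
  (x == tgt e)%:R - (x == src e)%:R.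

Lemma sum_incidence (u : grid_point -> rat) e : e \in E ->
  \sum_(x <- V) u x * incidence x e = u (tgt e) - u (src e).
Proof.
move=> eE; rewrite /incidence.
under eq_bigr do rewrite mulrBr.
rewrite sumrB (sum_pick _ (q := tgt e)) ?fset_uniq ?eqxx ?(mem_tgt eE) //; last first.
  by move=> r _ /negPf->.
rewrite (sum_pick _ (q := src e)) ?fset_uniq ?eqxx ?(mem_src eE) //.
by move=> r _ /negPf->.
Qed.

(** * The left kernel: components *)

Lemma mem_components C : (C \in K) <-> components D C.
Proof. by rewrite in_fset_set ?inE //; exact: components_finite. Qed.

Definition comp_ind (C : set pixel) (x : grid_point) : rat :=
  `[< exists2 p, C p & x \in vertices p >]%:R.

(** Two pixels of [D] at a common vertex are equal or 0-adjacent, so any pixel of [D] at [x] decides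
    whether [C] touches [x]. *)
Lemma comp_indE C p x : components D C -> p \in D -> x \in vertices p ->
  comp_ind C x = `[< C p >]%:R.
Proof.
move=> Ccomp pD xp; congr (_%:R); congr nat_of_bool.
apply: asbool_equiv_eq; split; last by exists p.
case=> q Cq xq; have [_ CD _ _] := Ccomp.
rewrite (component_linked adj0_sym Ccomp Cq).
have qD : q \in D by exact: (CD q).
have [->|qp] := eqVneq q p; first exact: linked_refl.
by apply: linked_adj => //; exact: (@vertex_adj0 x).
Qed.

Let comp := linked pixel_adj0 [set` D]%classic.

Lemma sum_comp_ind (w : set pixel -> rat) p x : p \in D -> x \in vertices p ->
  \sum_(C <- K) w C * comp_ind C x = w (comp p).
Proof.
move=> pD xp; have pcomp : components D (comp p) by exact: linked_component adj0_sym _ pD.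
apply: sum_pick; rewrite ?fset_uniq //.
- exact/mem_components.
- by rewrite (comp_indE _ pD xp) // asboolT //; exact: linked_refl.
- move=> C /mem_components Ccomp; rewrite (comp_indE Ccomp pD xp) => Cp.
  case: asboolP => // /(component_linked adj0_sym Ccomp) CE.
  by rewrite CE eqxx in Cp.
Qed.

Lemma comp_ind_inj (w : set pixel -> rat) :
  {in V, forall x, \sum_(C <- K) w C * comp_ind C x = 0} -> {in K, w =1 fun=> 0}.
Proof.
move=> w0 C /mem_components Ccomp; have [[p Cp] CD _ _] := Ccomp.
have pD : p \in D by exact: (CD p).
(* Read as a grid point, [p] is its own north-east vertex. *)
have xp : p \in vertices p by rewrite mem_vertices !eqxx.
rewrite (component_linked adj0_sym Ccomp Cp) -(sum_comp_ind w pD xp) w0 //.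
by apply/mem_vertex_setP; exists p.
Qed.

Lemma comp_ind_ker :
  {in K & E, forall C e, \sum_(x <- V) comp_ind C x * incidence x e = 0}.
Proof.
move=> C e /mem_components Ccomp eE; rewrite sum_incidence //.
have [? ? ? ?] := mem_vertices_side e.
by have := eE; rewrite mem_edge_set => /orP[] eD; rewrite !(comp_indE Ccomp eD) ?subrr.
Qed.

(** Zero coboundary makes [u] constant on the corners of each pixel of [D], and shared vertices
    carry this value through the 0-component. *)
Lemma ker_comp_ind (u : grid_point -> rat) :
  {in E, forall e, \sum_(x <- V) u x * incidence x e = 0} ->
  exists w, {in V, forall x, u x = \sum_(C <- K) w C * comp_ind C x}.
Proof.
move=> u0.
have uE e : e \in E -> u (tgt e) = u (src e).
  by move=> eE; apply/eqP; rewrite -subr_eq0 -sum_incidence // u0.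
have uV p x : p \in D -> x \in vertices p -> u x = u (ne p).
  case: p => a b pD.
  have e1 : u (a, b - 1) = u (a - 1, b - 1).
    by rewrite -(uE (true, (a - 1, b - 1))) ?mem_edge_set /lside /rside /tgt /= ?subrK ?pD.
  have e2 : u (a, b) = u (a - 1, b).
    by rewrite -(uE (true, (a - 1, b))) ?mem_edge_set /lside /rside /tgt /= ?subrK ?pD ?orbT.
  have e3 : u (a - 1, b) = u (a - 1, b - 1).
    by rewrite -(uE (false, (a - 1, b - 1))) ?mem_edge_set /lside /rside /tgt /= ?subrK ?pD ?orbT.
  by rewrite !inE /sw /se /nw /ne /= => /or4P[] /eqP->; rewrite ?e1 ?e2 ?e3.
(* The weight of [C] is read off at a chosen pixel; the default [(0, 0)] never matters, since
   components are nonempty. *)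
exists (fun C => u (ne (xget (0, 0) C))) => x /mem_vertex_setP[p pD xp].
rewrite (sum_comp_ind _ pD xp) (uV p) //.
have pq : comp p (xget (0, 0) (comp p)) by apply: (xgetPex (0, 0)); exists p; exact: linked_refl.
apply: (linked_ind (f := fun q => u (ne q))) pq => q r qD rD /adj0_vertex[y yq yr].
by rewrite -(uV q y) // -(uV r y).
Qed.

(** * The right kernel: pixels and holes *)

Lemma mem_holes C : (C \in H) <-> holes D C.
Proof.
rewrite in_fset_set ?inE //.
by have [N DN] := pixel_bound D; exact: holes_finite DN.
Qed.

Definition faces : seq (pixel + set pixel) := map inl D ++ map inr H.

Lemma faces_uniq : uniq faces.
Proof.
have inl_inj : injective (@inl pixel (set pixel)) by move=> ? ? [].
have inr_inj : injective (@inr pixel (set pixel)) by move=> ? ? [].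
rewrite cat_uniq !map_inj_uniq // !fset_uniq andbT /=.
by apply/hasPn => _ /mapP[C _ ->]; apply/negP => /mapP[].
Qed.

Lemma mem_faces_inl p : (inl p \in faces) = (p \in D).
Proof.
rewrite mem_cat mem_map; last by move=> ? ? [].
by rewrite orbC; case: mapP => // -[].
Qed.

Lemma mem_faces_inr C : (inr C \in faces) = (C \in H).
Proof.
rewrite mem_cat orbC mem_map; last by move=> ? ? [].
by rewrite orbC; case: mapP => // -[].
Qed.

Definition face_ind (q : pixel + set pixel) (p : pixel) : rat :=
  match q with inl p' => p == p' | inr C => `[< C p >] end%:R.

(** The cellular boundary of the 2-chain [f], all pixels being oriented counterclockwise. *)
Definition boundary (f : pixel -> rat) (e : grid_edge) : rat :=
  f (lside e) - f (rside e).

(** A hole is an entire 1-component, so it contains both complement pixels or neither; a pixel of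
    [D] equals neither. *)
Lemma face_ind_bg q p p' : q \in faces -> bg p -> bg p' -> pixel_adj1 p p' ->
  face_ind q p = face_ind q p'.
Proof.
move=> + pB p'B pp'; case: q => [r|C].
  rewrite mem_faces_inl /face_ind => rD.
  have [pr|_] := eqVneq p r; first by case: pB; rewrite /= pr.
  by have [pr|//] := eqVneq p' r; case: p'B; rewrite /= pr.
rewrite mem_faces_inr => /mem_holes[Ccomp _].
congr (_%:R); congr nat_of_bool; apply: asbool_equiv_eq; split=> Cp;
  rewrite (component_linked adj1_sym Ccomp Cp); apply: linked_adj => //.
by rewrite adj1_sym.
Qed.

Lemma boundary_face_ind q e : q \in faces -> e \notin E -> boundary (face_ind q) e = 0.
Proof.
move=> qQ; rewrite mem_edge_set negb_or => /andP[/negP eD1 /negP eD2].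
by apply/eqP; rewrite subr_eq0; apply/eqP/face_ind_bg => //; exact: adj1_sides.
Qed.

(** Since [G] vanishes off [E], [e0] may be any grid edge; the four edges at a grid point can then
    be treated alike. *)
Lemma sum_edge (G : grid_edge -> rat) e0 : {in predC (mem E), G =1 fun=> 0} ->
  \sum_(e <- E) G e * (e == e0)%:R = G e0.
Proof.
move=> G0; have [e0E|e0E] := boolP (e0 \in E).
  by apply: sum_pick; rewrite ?fset_uniq ?eqxx // => r _ /negPf->.
rewrite G0 // big_seq big1 // => e eE.
by have [ee0|] := eqVneq e e0; rewrite ?mulr0 //; rewrite -ee0 eE in e0E.
Qed.

(** The boundary of a boundary is zero: each of the four pixels around [x] borders two of the four
    edges at [x], with opposite signs. *)
Lemma boundary_cycle (f : pixel -> rat) x : {in predC (mem E), boundary f =1 fun=> 0} ->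
  \sum_(e <- E) boundary f e * incidence x e = 0.
Proof.
case: x => a b f0.
have dE e : incidence (a, b) e =
    (e == (true, (a - 1, b)))%:R + (e == (false, (a, b - 1)))%:R
    - ((e == (true, (a, b)))%:R + (e == (false, (a, b)))%:R).
  have BR (u v : int) : (u == v + 1) = (v == u - 1) by lia.
  case: e => [[] [c d]]; rewrite /incidence /tgt /src !xpair_eqE /=;
    by rewrite ?addr0 ?add0r BR ![_ == c]eq_sym ![_ == d]eq_sym.
under eq_bigr do rewrite dE mulrBr !mulrDr.
rewrite sumrB !big_split /= !sum_edge // /boundary /lside /rside /= !subrK.
ring.
Qed.

Let face_sum (w : pixel + set pixel -> rat) (p : pixel) :=
  \sum_(q <- faces) w q * face_ind q p.

Lemma boundary_face_sum w e :
  boundary (face_sum w) e = \sum_(q <- faces) w q * boundary (face_ind q) e.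
Proof. by rewrite /boundary -sumrB; apply: eq_bigr => q _; rewrite mulrBr. Qed.

(** Pixels of [D] and holes are pairwise disjoint, so at most one term survives at any pixel, here
    and in the next two lemmas. *)
Lemma face_sum_pixel w p : p \in D -> face_sum w p = w (inl p).
Proof.
move=> pD; apply: sum_pick.
- exact: faces_uniq.
- by rewrite mem_faces_inl.
- by rewrite /face_ind eqxx.
- move=> [q _|C]; first by rewrite /face_ind eq_sym (inj_eq (@inl_inj _ _)) => /negPf->.
  rewrite mem_faces_inr => /mem_holes[[_ CD _ _] _] _; rewrite /face_ind.
  by case: asboolP => // /CD /(_ pD).
Qed.

Lemma face_sum_hole w C p : holes D C -> C p -> face_sum w p = w (inr C).
Proof.
move=> Chole Cp; have [Ccomp _] := Chole; have [_ CD _ _] := Ccomp.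
apply: sum_pick.
- exact: faces_uniq.
- by rewrite mem_faces_inr; exact/mem_holes.
- by rewrite /face_ind asboolT.
- move=> [q|C'].
    rewrite mem_faces_inl /face_ind => qD _.
    by have [pq|//] := eqVneq p q; case: (CD p Cp); rewrite /= pq.
  rewrite mem_faces_inr => /mem_holes[C'comp _] C'C; rewrite /face_ind.
  case: asboolP => // C'p; case/eqP: C'C; congr inr.
  rewrite (component_linked adj1_sym C'comp C'p).
  by rewrite (component_linked adj1_sym Ccomp Cp).
Qed.

Lemma face_sum_outer w p : bg p -> (forall C, holes D C -> ~ C p) -> face_sum w p = 0.
Proof.
move=> pB nC; rewrite /face_sum big_seq big1 // => -[q|C].
  rewrite mem_faces_inl /face_ind => qD.
  by have [pq|] := eqVneq p q; rewrite ?mulr0 //; case: pB; rewrite /= pq.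
rewrite mem_faces_inr => /mem_holes/nC nCp.
by rewrite /face_ind asboolF // mulr0.
Qed.

(** A 2-chain without boundary is constant along rows, and it vanishes outside the box, where there
    are no faces. *)
Lemma face_ind_inj (w : pixel + set pixel -> rat) :
  {in E, forall e, \sum_(q <- faces) w q * boundary (face_ind q) e = 0} ->
  {in faces, w =1 fun=> 0}.
Proof.
move=> w0.
have b0 e : boundary (face_sum w) e = 0.
  rewrite boundary_face_sum; have [/w0//|eE] := boolP (e \in E).
  by rewrite big_seq big1 // => q qQ; rewrite boundary_face_ind ?mulr0.
have [N DN] := pixel_bound D.
have f_shift a b (n : nat) : face_sum w (a, b) = face_sum w (a - n%:Z, b).
  elim: n => [|n ->]; first by rewrite subr0.
  have /eqP := b0 (false, (a - n.+1%:Z, b - 1)).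
  rewrite /boundary subr_eq0 /lside /rside /= subrK => /eqP->.
  by congr (face_sum w (_, _)); lia.
have f0 p : face_sum w p = 0.
  (* This shift lands strictly to the left of the box, whatever the sign of [N]. *)
  case: p => a b; rewrite (f_shift _ _ (`|a| + `|N|).+1).
  set p : pixel := (_, _).
  have pN : ~ (`|p.1| <= N) && (`|p.2| <= N) by rewrite /p /=; lia.
  apply: face_sum_outer => [/DN//|C Chole Cp].
  exact/pN/(hole_bounded DN Chole).
move=> [p|C].
  by rewrite mem_faces_inl => pD; rewrite -(face_sum_pixel w pD).
rewrite mem_faces_inr => /mem_holes Chole.
have [[[p Cp] _ _ _] _] := Chole.
by rewrite -(face_sum_hole w Chole Cp).
Qed.

(** The lower bound is [- N - 1] because a flanking pixel may have first coordinate [e.2.1 + 1]. The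
    row is bounded for vertical edges, the only ones a horizontal ray crosses. *)
Lemma edge_bound (N : int) (e : grid_edge) :
  (forall p : pixel, p \in D -> (`|p.1| <= N) && (`|p.2| <= N)) ->
  e \in E -> [/\ - N - 1 <= e.2.1, e.2.1 <= N & ~~ e.1 -> - N <= e.2.2 + 1 <= N].
Proof.
move=> DN; rewrite mem_edge_set => /orP[] /DN; case: e => [[] [x y]];
  rewrite /lside /rside /= => h; split=> //; lia.
Qed.

(** A discrete Poincaré lemma: the cycle is the boundary of a 2-chain [f] that is constant on the
    1-components of the complement and zero on the unbounded one, hence a combination of faces. *)
Lemma ker_face_ind (g : grid_edge -> rat) :
  {in V, forall x, \sum_(e <- E) g e * incidence x e = 0} ->
  exists w, {in E, forall e, g e = \sum_(q <- faces) w q * boundary (face_ind q) e}.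
Proof.
move=> gcycle.
(* A cycle pairs to zero with every coboundary. *)
have pairing (u : grid_point -> rat) : \sum_(e <- E) g e * (u (tgt e) - u (src e)) = 0.
  under eq_big_seq => e eE do rewrite -sum_incidence // mulr_sumr.
  rewrite exchange_big big_seq big1 //= => x xV.
  under eq_bigr do rewrite mulrCA.
  by rewrite -mulr_sumr gcycle ?mulr0.
(* [f p] integrates the cycle along the horizontal ray from [p] to the left,
   which crosses exactly the edges [e] with [cross p e]. *)
pose cross (p : pixel) (e : grid_edge) := [&& ~~ e.1, e.2.2 + 1 == p.2 & e.2.1 < p.1].
pose f (p : pixel) : rat := - \sum_(e <- E) g e * (cross p e)%:R.
have fE e0 : boundary f e0 = \sum_(e <- E) g e * (e == e0)%:R.
  rewrite /boundary /f opprK addrC -sumrB.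
  case: e0 => [[] [a b]].
    (* The two rays bound the half-row [x.2 = b, x.1 <= a] of grid points. *)
    apply/eqP; rewrite -subr_eq0 -sumrB; apply/eqP.
    rewrite -[RHS](pairing (fun x => ((x.2 == b) && (x.1 <= a))%:R)).
    apply: eq_bigr => -[[] [x y]] _; rewrite -!mulrBr; congr (_ * _);
      rewrite /cross /lside /rside /tgt /src xpair_eqE /= ?xpair_eqE.
      have -> : (x == a) = (x <= a) && ~~ (x + 1 <= a) by lia.
      have : (x + 1 <= a) ==> (x <= a) by lia.
      by case: (y == b); case: (x <= a); case: (x + 1 <= a).
    by rewrite (inj_eq (addIr 1)) !ltzD1 subr0.
  (* For a vertical [e0], both rays lie in the same row and differ only in crossing [e0]. *)
  apply: eq_bigr => -[[] [x y]] _; rewrite -!mulrBr; congr (_ * _);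
    rewrite /cross /lside /rside /= xpair_eqE /= ?xpair_eqE ?subrr //.
  have -> : (x == a) = (x < a + 1) && ~~ (x < a) by lia.
  have : (x < a) ==> (x < a + 1) by lia.
  by rewrite (inj_eq (addIr 1)); case: (y == b); case: (x < a + 1); case: (x < a).
have fE0 e : e \notin E -> boundary f e = 0.
  move=> eE; rewrite fE big_seq big1 // => e' e'E.
  by have [ee|] := eqVneq e' e; rewrite ?mulr0 //; rewrite -ee e'E in eE.
have fEg e : e \in E -> boundary f e = g e.
  move=> eE; rewrite fE; apply: sum_pick; rewrite ?fset_uniq ?eqxx //.
  by move=> r _ /negPf->.
(* A step inside the complement crosses an edge outside [E], where [f] does not jump. *)
have f_bg p q : linked pixel_adj1 bg p q -> f p = f q.
  apply: linked_ind => {}p {}q pB qB /adj1_edge[e pqe].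
  have eE : e \notin E.
    rewrite mem_edge_set; apply/negP => /orP[] eD;
    by case: pqe => -[pe qe]; move: pB qB; rewrite pe qe => lB rB; first [exact: lB | exact: rB].
  by have /eqP := fE0 e eE; rewrite subr_eq0 => /eqP fe; case: pqe => -[-> ->].
have [N DN] := pixel_bound D.
have EN := edge_bound DN.
have f_out (p : pixel) : ~~ ((`|p.1| <= N) && (`|p.2| <= N)) -> f p = 0.
  move=> pN; apply/eqP; rewrite oppr_eq0; apply/eqP.
  have [p1N|p1N] := lerP p.1 N.
    (* To the left of the box, above it or below it, the ray meets no edge of [E]. *)
    rewrite big_seq big1 // => e /EN[e1 e2 e3].
    suff -> : cross p e = false by rewrite mulr0.
    rewrite /cross; case: (e.1) e3 => //= /(_ isT); lia.
  (* To the right of [D], the ray crosses everything in its row. *)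
  rewrite -[RHS](pairing (fun x => (p.2 <= x.2)%R%:R)).
  apply: eq_big_seq => -[[] [x y]] /EN[/= e1 e2 e3]; rewrite /cross /tgt /src /=.
    by rewrite subrr.
  congr (_ * _); have -> : x < p.1 by lia.
  have -> : (y + 1 == p.2) = (p.2 <= y + 1) && ~~ (p.2 <= y) by lia.
  have : (p.2 <= y) ==> (p.2 <= y + 1) by lia.
  by case: (p.2 <= y); case: (p.2 <= y + 1).
exists (fun q => match q with inl p => f p | inr C => f (xget (0, 0) C) end) => e eE.
rewrite -boundary_face_sum -fEg // /boundary.
suff W p : face_sum (fun q => match q with inl p => f p | inr C => f (xget (0, 0) C) end) p = f p.
  by rewrite !W.
have [pD|/negP pB] := boolP (p \in D); first by rewrite face_sum_pixel.
have [[C [Chole Cp]]|nC] := pselect (exists C, holes D C /\ C p).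
  rewrite (face_sum_hole _ Chole Cp); have [Ccomp _] := Chole.
  apply/esym/f_bg; rewrite -(component_linked adj1_sym Ccomp Cp).
  by apply: (xgetPex (0, 0)); exists p.
rewrite face_sum_outer //; last by move=> C Chole Cp; apply: nC; exists C.
(* A class lying in no hole must leave the box, where [f] vanishes: confined to the box it would be
   finite, hence a hole. *)
have [[q [pq qN]]|inN] := pselect (exists q, linked pixel_adj1 bg p q /\
    ~~ ((`|q.1| <= N) && (`|q.2| <= N))).
  by rewrite (f_bg _ _ pq) f_out.
case: nC; exists (linked pixel_adj1 bg p); split; last exact: linked_refl.
split; first exact: linked_component adj1_sym _ pB.
apply: sub_finite_set (box_finite N) => q pq /=.
by apply/negPn/negP => qN; apply: inN; exists q.
Qed.

(** * Euler's formula and the conclusion *)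

Lemma euler_formula :
  (#|` V| + (#|` D| + set_card (holes D)) = #|` E| + set_card (components D))%N.
Proof.
have sizeQ : size faces = (#|` D| + set_card (holes D))%N.
  by rewrite size_cat !size_map.
rewrite -sizeQ; apply: (@euler_exact rat _ _ _ _ K V E faces comp_ind incidence
  (fun q => boundary (face_ind q))); rewrite ?fset_uniq ?faces_uniq //.
- exact: comp_ind_inj.
- exact: comp_ind_ker.
- exact: ker_comp_ind.
- exact: face_ind_inj.
- move=> q x qQ _; apply: boundary_cycle => e eE; exact: boundary_face_ind.
- exact: ker_face_ind.
Qed.

End Exactness.

Unset Implicit Arguments.

Theorem theorem1 (D : {fset pixel}) (hD : D != fset0) :
  let p := #|` D | in
  let v := set_card (object_vertices D) in
  let h := set_card (holes D) in
  let c := set_card (components D) in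
  let b := set_card (blocks D) in
  let t := set_card (tunnels D) in
  t%:Z = v%:Z - 2 * (p%:Z + c%:Z - h%:Z) + b%:Z.
Proof.
move=> p v h c b t.
have := edges_count D; have := euler_formula D.
rewrite -card_object_vertices -/p -/v -/h -/c -/b -/t.
lia.
Qed.
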